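(* Let $\mathcal{T}=(V,E,\varrho)$ be a locally finite, infinite rooted tree of intermediate growth. For a parameter $\lambda\ge 0$, consider the percolation on $\mathcal{T}$ in which the edges are open independently, with $$\mathbb{P}_\lambda[e\text{ is open}]=\exp\left(-|e|^{-1+\lambda}\right)\qquad(e\in E),$$ and let $\{\varrho\leftrightarrow\infty\}$ be the event that there is an infinite self-avoiding path of open edges starting at $\varrho$. Put $$\Theta(\mathcal{T})=\sup\{\lambda\ge 0:\ \mathbb{P}_\lambda[\varrho\leftrightarrow\infty]>0\}.$$ Then $\Theta(\mathcal{T})=\mathrm{IBN}(\mathcal{T})$.
   Context: For a rooted tree $\mathcal{T}=(V,E,\varrho)$, $|v|$ is the graph distance from $v$ to the root $\varrho$. For an edge $e$ with endpoints $e^-,e^+$ where $|e^+|=|e^-|+1$, put $|e|=|e^+|$. Let $E_n=\{x\in V: |x|=n\}$. The tree is of intermediate growth if $$0<\liminf_{n\to\infty}\frac{\log\log\#E_n}{\log n}\le\limsup_{n\to\infty}\frac{\log\log\#E_n}{\log n}<1.$$ A cutset is a set $\pi\subset E$ such that every infinite self-avoiding path from $\varrho$ to infinity has exactly one edge in $\pi$; $\Pi$ is the set of all cutsets. The intermediate branching number is $$\mathrm{IBN}(\mathcal{T})=\sup\Big\{\lambda>0:\ \inf_{\pi\in\Pi}\sum_{e\in\pi}\exp(-|e|^{\lambda})>0\Big\}.$$ Throughout, $\sup\emptyset=0$ (for both suprema). *)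

(* Defs.v *)
From HB Require Import structures.
From mathcomp Require Import all_boot all_order all_algebra finmap.
From mathcomp Require Import all_classical all_reals all_analysis.

Set Implicit Arguments.
Unset Strict Implicit.
Unset Printing Implicit Defensive.

Import Order.TTheory GRing.Theory Num.Theory.

Local Open Scope classical_set_scope.
Local Open Scope ring_scope.

(* [x :: p] is the list of vertices of a self-avoiding path from x to y. *)
Definition simple_path (V : eqType) (adj : rel V) (x y : V) (p : seq V) : Prop :=
  [/\ path adj x p, last x p = y & uniq (x :: p)].

Record rooted_tree := RootedTree {
  vertex : choiceType;
  adj : rel vertex;
  root : vertex;
  adj_sym : symmetric adj;
  adj_irr : irreflexive adj;
  unique_simple_path : forall x y, exists! p : seq vertex, simple_path adj x y p
}.

Section Tree.
Variable T : rooted_tree.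
Implicit Types x y : vertex T.

Definition walk_length x y (n : nat) : Prop :=
  exists p : seq (vertex T), [/\ path (@adj T) x p, last x p = y & size p = n].

Lemma walk_length_ex x y : exists n, `[< walk_length x y n >].
Proof.
have [p [[pxp pl _] _]] := unique_simple_path x y.
by exists (size p); apply/asboolP; exists p.
Qed.

Definition dist x y : nat := ex_minn (walk_length_ex x y).

Definition level x : nat := dist x (root T).

Definition locally_finite : Prop := forall x, finite_set [set y | adj x y].

(* An edge is stored as the pair (e^-, e^+) of its endpoints, the farther one
   from the root second; in a tree each undirected edge has exactly one such
   orientation. *)
Definition edge : Type :=
  {e : vertex T * vertex T | adj e.1 e.2 && (level e.2 == (level e.1).+1)}.

Definition elevel (e : edge) : nat := level (val e).2.

Definition joins (e : edge) x y : Prop := val e = (x, y) \/ val e = (y, x).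

Definition sphere (n : nat) : set (vertex T) := [set x | level x = n].

(* Infinite self-avoiding paths started at the root. *)
Definition ray (g : nat -> vertex T) : Prop :=
  [/\ g 0%N = root T, forall n, adj (g n) (g n.+1) & injective g].

Definition ray_edge (g : nat -> vertex T) (e : edge) : Prop :=
  exists n, joins e (g n) (g n.+1).

Definition cutset (pi : set edge) : Prop :=
  forall g, ray g -> exists! e, pi e /\ ray_edge g e.

End Tree.

HB.instance Definition _ (T : rooted_tree) := [Choice of edge T by <:].

(* [lne] is the extended logarithm ([lne x = -oo] for x <= 0), so the ratio is
   -oo, and not a junk real, when #E_n = 1 and n >= 2. *)
Definition growth_ratio (R : realType) (T : rooted_tree) (n : nat) : \bar R :=
  (lne (lne (#|` fset_set (@sphere T n)|%:R)%:E) * ((ln n%:R)^-1)%:E)%E.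

Definition intermediate_growth (R : realType) (T : rooted_tree) : Prop :=
  (0 < limn_einf (@growth_ratio R T))%E /\
  (limn_esup (@growth_ratio R T) < 1)%E.

(* Supremum of a set of nonnegative reals, with sup of the empty set = 0. *)
Definition sup_or0 (R : realType) (A : set R) : \bar R :=
  if `[< A = set0 >] then 0%E else ereal_sup (EFin @` A).

Definition cut_weight (R : realType) (T : rooted_tree) (lam : R)
    (pi : set (edge T)) : \bar R :=
  (\esum_(e in pi) (expR (- ((elevel e)%:R `^ lam)))%:E)%E.

Definition IBN (R : realType) (T : rooted_tree) : \bar R :=
  sup_or0 [set lam : R | 0 < lam /\
    (0 < ereal_inf [set cut_weight lam pi | pi in @cutset T])%E].

Section Percolation.
Context (R : realType) (d : measure_display) (Omega : measurableType d).
Variable P : probability Omega R.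

Definition mutually_independent (I : choiceType) (A : I -> set Omega) : Prop :=
  forall J : {fset I},
    P (\bigcap_(i in [set` J]) A i) = (\prod_(i <- J) P (A i))%E.

(* [op e] is the event that the edge e is open. *)
Definition bernoulli_percolation (T : rooted_tree) (p : edge T -> R)
    (op : edge T -> set Omega) : Prop :=
  [/\ forall e, measurable (op e),
      mutually_independent op &
      forall e, P (op e) = (p e)%:E].

Definition percolates (T : rooted_tree) (op : edge T -> set Omega) : set Omega :=
  [set w | exists g, ray g /\ forall e, ray_edge g e -> op e w].

End Percolation.

Definition open_prob (R : realType) (T : rooted_tree) (lam : R) (e : edge T) : R :=
  expR (- ((elevel e)%:R `^ (-1 + lam))).

Definition Theta (R : realType) (T : rooted_tree) (d : measure_display)
    (Omega : R -> measurableType d) (P : forall lam, probability (Omega lam) R)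
    (op : forall lam, edge T -> set (Omega lam)) : \bar R :=
  sup_or0 [set lam : R | 0 <= lam /\ (0 < P lam (percolates (op lam)))%E].

(* Main.v *)
Require Import Defs.
From HB Require Import structures.
From mathcomp Require Import all_boot all_order all_algebra finmap.
From mathcomp Require Import all_classical all_reals all_analysis.
From mathcomp Require Import measurable_realfun zify ring lra.

Set Implicit Arguments.
Unset Strict Implicit.
Unset Printing Implicit Defensive.

Import Order.TTheory GRing.Theory Num.Theory.

Local Open Scope classical_set_scope.
Local Open Scope ring_scope.

(** Write [Q n] for the probability that the path from the root to a vertex of
    level [n] is open, so that [- ln (Q n) = \sum_(1 <= k < n.+1) k `^ (-1 + lam)].
    For [0 < lam <= 1] this sum lies between [n `^ lam] and, if [lam < 1],
    [n `^ lam / lam], which is why the exponents [-1 + lam] of the percolation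
    and [lam] of the cutset sums correspond to each other.

    Percolation at [lam > 0] gives a bound on cutsets ([prob_percolates_le]): an
    infinite open path crosses every cutset, hence its probability is at most
    the sum of [Q (elevel e)] over the edges [e] of the cutset.  By the lower bound
    on [- ln (Q n)] this is at most [cut_weight lam], so that [lam] is admissible in
    the definition of [IBN].  The values [lam > 1] are excluded with the cutset of
    all edges of level [n], because the level sizes grow more slowly than [expR n]
    ([subexponential_growth], [percolation_le1]).

    Conversely, let the cutset sums at exponent [lam] be bounded below by
    [delta > 0], and let [0 < mu < lam]; then [mu < 1], again by the growth
    condition ([cut_weight_le1]).  Give every vertex of level [k] the capacity
    [expR (- k `^ lam)].  A greedily constructed maximal flow to level [n] saturates
    an ancestor of every vertex of level [n], and the topmost saturated vertices
    form a cutset ([flow_or_cut]); so the flow has strength at least [delta]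
    (or at least 1, if it is the root that is saturated), uniformly in [n].  The
    second moment method for the number of vertices of level [n] connected to the
    root, weighted by this flow, bounds the probability of reaching level [n] from
    below by [delta] divided by [\sum_k expR (- k `^ lam) / Q k]
    ([prob_percolates_gt0]).  With [Q] taken at the parameter [mu], this series
    converges since [k `^ mu / mu] is negligible against [k `^ lam]
    ([sum_stretched_exp_le]).  As a locally finite tree has an infinite open path from
    the root as soon as all levels are reached ([percolatesE]), there is percolation
    at [mu].  Letting [mu] tend to [lam] concludes. *)

(** * Parents and levels *)

Section TreeStructure.
Context (T : rooted_tree).
Local Open Scope nat_scope.
Local Notation rho := (Defs.root T).
Implicit Types (x y z : vertex T) (k m n : nat).

Definition to_root x : seq (vertex T) :=
  sval (cid (unique_simple_path x rho)).

Lemma to_rootP x : simple_path (@adj T) x rho (to_root x).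
Proof. by rewrite /to_root; case: cid => p []. Qed.

Lemma to_root_uniq x p : simple_path (@adj T) x rho p -> p = to_root x.
Proof. by rewrite /to_root; case: cid => q [_ /= h] /h. Qed.

Lemma level_size x : level x = size (to_root x).
Proof.
rewrite /level /dist; case: ex_minnP => n /asboolP[p [pp pl <-]] nmin.
apply/eqP; rewrite eqn_leq nmin /=; last first.
  by apply/asboolP; exists (to_root x); have [] := to_rootP x.
case/shortenP: pp pl => q qp qu qs ql.
rewrite -(@to_root_uniq x q); last by split.
by apply: uniq_leq_size => //; case/andP: qu.
Qed.

Definition parent x := head rho (to_root x).

Lemma to_root_root : to_root rho = [::].
Proof. by rewrite -(@to_root_uniq rho [::]) //; split. Qed.

Lemma level_root : level rho = 0.
Proof. by rewrite level_size to_root_root. Qed.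

Lemma parent_root : parent rho = rho.
Proof. by rewrite /parent to_root_root. Qed.

Lemma to_root_parent x : x != rho -> to_root x = parent x :: to_root (parent x).
Proof.
rewrite /parent; have := to_rootP x; case E: (to_root x) => [|y p].
  by case=> _ /= -> _; rewrite eqxx.
move=> [/= /andP[_ pp] pl /andP[_ pu]] _; congr cons.
by apply: to_root_uniq; split.
Qed.

Lemma level_eq0 x : level x = 0 -> x = rho.
Proof.
move=> x0; have [//|/to_root_parent xp] := eqVneq x rho.
by move: x0; rewrite level_size xp.
Qed.

Lemma level_parent x : x != rho -> level x = (level (parent x)).+1.
Proof. by move=> /to_root_parent xr; rewrite !level_size xr. Qed.

Lemma level_parentE x : level (parent x) = (level x).-1.
Proof.
have [->|/level_parent -> //] := eqVneq x rho.
by rewrite parent_root level_root.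
Qed.

Lemma adj_parent x : x != rho -> adj (parent x) x.
Proof.
move=> /to_root_parent xr; have [] := to_rootP x.
by rewrite xr adj_sym /= => /andP[].
Qed.

(** A neighbour [y] of [x] either lies off the path from [x] to the root, and
    then prolonging that path by [y] gives the path from [y]; or it lies on it,
    and then the single edge and the initial segment of the path are two simple
    paths from [x] to [y], hence equal. *)
Lemma adj_parentP x y : adj x y -> y = parent x \/ x = parent y.
Proof.
move=> xy; have xNy : x != y by apply: contraTneq xy => ->; rewrite adj_irr.
have [pp pl pu] := to_rootP x.
have [yx|yNx] := boolP (y \in to_root x); last first.
  right; rewrite /parent -(@to_root_uniq y (x :: to_root x)) //.
  split => //=; first by rewrite adj_sym xy.
  by rewrite inE negb_or eq_sym xNy yNx.
left; move: pp pl pu; rewrite /parent.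
case/splitPr: yx => p1 p2; rewrite cat_path => /andP[p1p p2p] _.
have ly : adj (last x p1) y by case/andP: p2p.
rewrite -cat_rcons -cat_cons cat_uniq => /and3P[u1 _ _].
have [q [_ qU]] := unique_simple_path x y.
have e1 : q = rcons p1 y.
  by apply: qU; split=> //; rewrite ?rcons_path ?p1p ?last_rcons.
have e2 : q = [:: y].
  by apply: qU; split=> //=; rewrite ?xy // inE xNy.
by case: p1 e1 {p1p p2p ly u1} => [|a [|b p1]] //= e1; move: e2; rewrite e1.
Qed.

Lemma edge_parent (e : edge T) : (val e).1 = parent (val e).2.
Proof.
have /andP[/adj_parentP[ep|//] /eqP el] := valP e.
by move: el; rewrite {1}ep level_parentE; lia.
Qed.


Definition far_end (e : edge T) : vertex T := (val e).2.

Lemma edgeE (e : edge T) : val e = (parent (far_end e), far_end e).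
Proof. by rewrite /far_end -edge_parent; case: (val e). Qed.

Lemma far_end_inj : injective far_end.
Proof. by move=> e f ef; apply: val_inj; rewrite /= !edgeE ef. Qed.

Lemma far_end_neq_root (e : edge T) : far_end e != rho.
Proof.
have /andP[_ /eqP el] := valP e; rewrite /far_end.
by apply: contra_eq_neq el => ->; rewrite level_root.
Qed.

Lemma elevel_gt0 (e : edge T) : 0 < elevel e.
Proof. by have /andP[_ /eqP el] := valP e; rewrite /elevel el. Qed.

Lemma edge_to_ex x : x != rho -> exists e : edge T, far_end e = x.
Proof.
move=> xr; have xe : adj (parent x, x).1 (parent x, x).2 &&
    (level (parent x, x).2 == (level (parent x, x).1).+1).
  by rewrite /= adj_parent //= (level_parent xr).
by exists (Sub (parent x, x) xe); rewrite /far_end SubK.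
Qed.

(** * Ancestors and spheres *)

(** The ancestor of [x] at level [k]; by truncated subtraction it is [x] itself
    when [k] exceeds the level of [x]. *)
Definition anc k x := iter (level x - k) parent x.

Lemma level_iter_parent j x : level (iter j parent x) = level x - j.
Proof. by elim: j => [|j ih] /=; rewrite ?subn0 // level_parentE ih subnS. Qed.

Lemma level_anc k x : k <= level x -> level (anc k x) = k.
Proof. by move=> kx; rewrite level_iter_parent subKn. Qed.

Lemma anc_level x : anc (level x) x = x.
Proof. by rewrite /anc subnn. Qed.

Lemma anc0 x : anc 0 x = rho.
Proof. by apply: level_eq0; rewrite level_anc. Qed.

Lemma anc_anc k m x : k <= m -> m <= level x -> anc k (anc m x) = anc k x.
Proof.
move=> km mx; rewrite {1}/anc level_anc // /anc -iterD; congr iter; lia.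
Qed.

Lemma parent_anc k x : k < level x -> parent (anc k.+1 x) = anc k x.
Proof. by move=> kx; rewrite /anc -iterS -subSn // subSS. Qed.

Lemma anc_parent k x : k < level x -> anc k (parent x) = anc k x.
Proof.
move=> kx; have -> : parent x = anc (level x).-1 x.
  by rewrite /anc -subn1 subKn //=; apply: leq_ltn_trans kx.
by rewrite anc_anc //; lia.
Qed.

Lemma anc_neq_root k x : 0 < k -> k <= level x -> anc k x != rho.
Proof.
by move=> k0 kx; apply: contraTneq k0 => /(congr1 (@level T));
  rewrite level_anc // level_root => ->.
Qed.

Lemma finite_sphere n : locally_finite T -> finite_set (@sphere T n).
Proof.
move=> lf; elim: n => [|n ih].
  apply: (@sub_finite_set _ _ [set rho]) => [x /= /level_eq0 //|].
  exact: finite_set1.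
apply: (@sub_finite_set _ _ (\bigcup_(x in @sphere T n) [set y | adj x y])).
  move=> y /= yn; have yr : y != rho.
    by apply: contra_eq_neq yn => ->; rewrite level_root.
  exists (parent y); last exact: adj_parent.
  by rewrite /sphere /= level_parentE yn.
exact: bigcup_finite.
Qed.

(** * Edge sets of the paths from the root *)

Definition path_edges x : set (edge T) :=
  [set e | elevel e <= level x /\ anc (elevel e) x = far_end e].

Lemma path_edges_root : path_edges rho = set0.
Proof.
rewrite -subset0 => e [] /=; rewrite level_root leqn0 => /eqP e0.
by have := elevel_gt0 e; rewrite e0.
Qed.

Lemma path_edgesS (e : edge T) :
  path_edges (far_end e) = e |` path_edges (parent (far_end e)).
Proof.
have le := level_parent (far_end_neq_root e).
apply/seteqP; split=> f /=.
  rewrite /path_edges /= leq_eqVlt => -[/orP[/eqP fe|fe] fa].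
    by left; apply: far_end_inj; rewrite -fa fe anc_level.
  by right; rewrite -ltnS -le anc_parent.
case=> [->|]; first by split=> //; rewrite anc_level.
rewrite /path_edges /= => -[fe fa]; rewrite -anc_parent ?le ?ltnS //.
by split=> //; exact: leqW.
Qed.

Lemma path_edgesN (e : edge T) : ~ path_edges (parent (far_end e)) e.
Proof.
case; rewrite level_parentE /elevel; have := elevel_gt0 e.
by rewrite /elevel -/(far_end e); lia.
Qed.

(** Induction along edges, away from the root. *)
Lemma tree_ind (Q : vertex T -> Prop) : Q rho ->
  (forall e : edge T, Q (parent (far_end e)) -> Q (far_end e)) -> forall x, Q x.
Proof.
move=> Q0 QS x; move: {2}(level x) (erefl (level x)) => n.
elim: n x => [x /level_eq0 -> //|n ih x xn].
have xr : x != rho by apply: contra_eq_neq xn => ->; rewrite level_root.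
have [e ex] := edge_to_ex xr; rewrite -ex; apply: QS; apply: ih.
by rewrite ex level_parentE xn.
Qed.

Lemma finite_path_edges x : finite_set (path_edges x).
Proof.
elim/tree_ind: x => [|e ih]; first by rewrite path_edges_root.
by rewrite path_edgesS; rewrite finite_setU; split=> //; exact: finite_set1.
Qed.

Lemma path_edges_anc m x : m <= level x ->
  path_edges (anc m x) = path_edges x `&` [set e | elevel e <= m].
Proof.
move=> mx; rewrite /path_edges level_anc //; apply/seteqP; split=> e /=.
  by case=> em; rewrite anc_anc // => ea; split=> //; split=> //; lia.
by case=> -[_ ea] em; rewrite anc_anc.
Qed.

(** [anc m x] is the last common ancestor: two vertices share their ancestors
    exactly up to its level. *)
Lemma path_edgesI x y : exists m, [/\ m <= level x, m <= level y,
  anc m x = anc m y & path_edges x `&` path_edges y = path_edges (anc m x)].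
Proof.
pose common m := (m <= minn (level x) (level y)) && (anc m x == anc m y).
have c0 : exists m, common m by exists 0; rewrite /common !anc0 eqxx.
have cb m : common m -> m <= level x by case/andP; rewrite leq_min => /andP[].
case: (ex_maxnP c0 cb) => m /andP[]; rewrite leq_min => /andP[mx my] /eqP ma mM.
exists m; split=> //; apply/seteqP; split=> e.
  case=> -[ex eax] -[ey eay]; rewrite path_edges_anc //; split; first by split.
  by apply: mM; rewrite /common leq_min ex ey eax eay eqxx.
move=> em; split; first by move: em; rewrite path_edges_anc // => -[].
by move: em; rewrite ma path_edges_anc // => -[].
Qed.

(** * Rays and cutsets *)

Lemma ray_parent (g : nat -> vertex T) n : ray g -> parent (g n.+1) = g n.
Proof.
move=> [g0 ga gi]; elim: n => [|n ih].
  have [g10|//] := adj_parentP (ga 0).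
  by have := gi 1 0; rewrite g10 g0 parent_root => /(_ erefl).
have [gn|//] := adj_parentP (ga n.+1).
by have := gi n.+2 n; rewrite gn ih => /(_ erefl); lia.
Qed.

Lemma level_ray (g : nat -> vertex T) n : ray g -> level (g n) = n.
Proof.
move=> gr; elim: n => [|n ih]; first by case: gr => ->; rewrite level_root.
rewrite level_parent ?ray_parent ?ih //.
by case: gr => g0 _ gi; rewrite -g0; apply/eqP => /gi.
Qed.

Lemma anc_ray (g : nat -> vertex T) k n : ray g -> k <= n -> anc k (g n) = g k.
Proof.
move=> gr; elim: n => [|n ih]; first by rewrite leqn0 => /eqP ->; rewrite anc0; case: gr.
rewrite leq_eqVlt => /orP[/eqP ->|kn]; first by rewrite -{1}(level_ray n.+1 gr) anc_level.
by rewrite -anc_parent ?ray_parent ?level_ray // ih.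
Qed.

Lemma ray_edgeP (g : nat -> vertex T) (e : edge T) : ray g ->
  ray_edge g e <-> g (elevel e) = far_end e.
Proof.
move=> gr; split.
  case=> n; rewrite /joins edgeE => -[] [eg1 eg2].
    by rewrite /elevel -/(far_end e) eg2 level_ray.
  by have := congr1 (@level T) eg1; rewrite level_parentE eg2 !level_ray //; lia.
move=> ge; have := elevel_gt0 e; case En : (elevel e) ge => [//|n] ge _.
by exists n; left; rewrite edgeE -ge ray_parent.
Qed.

Lemma parent_ray (g : nat -> vertex T) :
  g 0 = rho -> (forall n, g n.+1 != rho) -> (forall n, parent (g n.+1) = g n) -> ray g.
Proof.
move=> g0 gn gp; split=> // [n|i j ij].
  by rewrite -gp; exact: adj_parent.
have lg n : level (g n) = n.
  by elim: n => [|n ih]; rewrite ?g0 ?level_root // level_parent // gp ih.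
by rewrite -(lg i) ij lg.
Qed.

Lemma cutset_level n : 0 < n -> cutset [set e : edge T | elevel e = n].
Proof.
move=> n0 g gr; have gnr : g n != rho.
  case: (gr) => <- _ gi; apply/eqP => /gi; lia.
have [e eg] := edge_to_ex gnr; have en : elevel e = n.
  by rewrite /elevel -/(far_end e) eg level_ray.
exists e; split; first by split=> //; apply/ray_edgeP => //; rewrite en eg.
move=> f [/= fn /(ray_edgeP _ gr) fg]; apply: far_end_inj.
by rewrite eg -fg fn.
Qed.

End TreeStructure.

(** * Flows and cuts *)

(** Saturating the items one after the other, each as much as its resources
    allow, produces a maximal fractional packing: raising [w] at the new item [y]
    by the smallest slack of a resource used by [y] exhausts that resource, and
    the resources exhausted earlier stay so because loads only increase. *)
Lemma maximal_packing (R : realFieldType) (V Z : eqType) (K : finType) (k1 : K)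
    (use : K -> V -> Z) (c : K -> Z -> R) (s : seq V) :
  (forall k z, 0 <= c k z) -> uniq s ->
  exists w : V -> R, [/\ forall y, 0 <= w y,
    forall k z, \sum_(y <- s | use k y == z) w y <= c k z &
    forall y, y \in s -> exists k,
      \sum_(x <- s | use k x == use k y) w x = c k (use k y)].
Proof.
move=> c0; elim: s => [_|y s ih /= /andP[ys /ih[w [w0 wc ws]]]].
  by exists (fun=> 0); split=> // k z; rewrite big_nil.
pose slack k := c k (use k y) - \sum_(x <- s | use k x == use k y) w x.
have [k0 _ k0min] : exists2 k0, true & forall k, slack k0 <= slack k.
  by case: (@arg_minP _ _ _ k1 predT slack erefl) => k0 _ h; exists k0 => // k; exact: h.
pose w' x := if x == y then slack k0 else w x.
have slack0 k : 0 <= slack k by rewrite subr_ge0.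
have w'E k z : \sum_(x <- y :: s | use k x == z) w' x =
    (if use k y == z then slack k0 else 0) + \sum_(x <- s | use k x == z) w x.
  have e : \sum_(x <- s | use k x == z) w' x = \sum_(x <- s | use k x == z) w x.
    rewrite big_seq_cond [RHS]big_seq_cond; apply: eq_bigr => x /andP[xs _].
    by rewrite /w'; case: eqP => // xy; rewrite -xy xs in ys.
  by rewrite big_cons e /w' eqxx; case: ifP => // _; rewrite add0r.
have w'le k z : \sum_(x <- y :: s | use k x == z) w' x <= c k z.
  rewrite w'E; case: eqP => [<-|_]; last by rewrite add0r.
  by rewrite -lerBrDr; exact: k0min.
exists w'; split=> // [x|x]; first by rewrite /w'; case: ifP.
rewrite inE => /orP[/eqP ->|xs].
  by exists k0; rewrite w'E eqxx /slack subrK.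
have [k kx] := ws _ xs; exists k; apply: le_anti; rewrite w'le /= w'E -kx.
by rewrite lerDr; case: ifP.
Qed.

Section Flow.
Context (R : realType) (T : rooted_tree).
Hypothesis lf : locally_finite T.
Local Notation rho := (Defs.root T).

Definition Sphere n : {fset vertex T} := fset_set (@sphere T n).

Lemma in_Sphere n x : (x \in Sphere n) = (level x == n).
Proof.
rewrite in_fset_set; last exact: finite_sphere.
by apply/idP/eqP => [/set_mem|] //= xn; apply: mem_set.
Qed.

Definition load n (w : vertex T -> R) k z := \sum_(y <- Sphere n | anc k y == z) w y.

(** Take a maximal flow [w] to the sphere of radius [n].  Every vertex of this
    sphere has a saturated ancestor; if the root is not saturated, the topmost
    saturated vertices form a cutset, each of whose edges carries a flow equal
    to its capacity, so that the capacity of this cutset is at most the total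
    flow. *)
Lemma flow_or_cut (cap : nat -> R) n : (forall k, 0 < cap k) ->
  exists w : vertex T -> R, [/\ forall y, 0 <= w y,
    forall k z, (k <= n)%N -> load n w k z <= cap k &
    cap 0%N <= \sum_(y <- Sphere n) w y \/
    exists2 pi : set (edge T), cutset pi &
      (\esum_(e in pi) (cap (elevel e))%:E <= (\sum_(y <- Sphere n) w y)%:E)%E].
Proof.
move=> cap0.
have [w [w0 wc ws]] := @maximal_packing R _ _ 'I_n.+1 ord0
  (fun k y => anc k y) (fun k _ => cap k) _ (fun k _ => ltW (cap0 k)) (fset_uniq (Sphere n)).
exists w; split=> // [k z kn|]; first exact: (wc (Ordinal (kn : (k < n.+1)%N)) z).
have total : load n w 0 rho = \sum_(y <- Sphere n) w y.
  by apply: eq_bigl => y; rewrite anc0 eqxx.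
have [|unsat] := leP (cap 0%N) (\sum_(y <- Sphere n) w y); [by left|right].
pose sat x := load n w (level x) x == cap (level x).
pose top x := [&& sat x, (level x <= n)%N &
  [forall j : 'I_(level x), ~~ sat (anc j x)]].
have topP x j : top x -> (j < level x)%N -> ~~ sat (anc j x).
  by case/and3P=> _ _ /forallP h jx; exact: (h (Ordinal jx)).
(* Of two distinct ancestors of a vertex, one is a strict ancestor of the other,
   which therefore is not topmost. *)
have top_inj y j k : (j <= level y)%N -> (k <= level y)%N ->
    top (anc j y) -> top (anc k y) -> j = k.
  wlog jk : j k / (j <= k)%N.
    by move=> h jy ky tj tk; case/orP: (leq_total j k) => /h h'; [|symmetry]; exact: h'.
  move=> jy ky tj tk; apply/eqP; rewrite eqn_leq jk /= leqNgt; apply/negP => jk'.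
  have := topP _ j tk; rewrite level_anc // anc_anc // => /(_ jk') /negP; apply.
  by case/and3P: tj.
exists [set e | top (far_end e)].
  move=> g gr; have gn : g n \in Sphere n by rewrite in_Sphere level_ray.
  pose gsat k := (k <= n)%N && sat (g k).
  have gsat_ex : exists k, gsat k.
    have [k ks] := ws _ gn; exists k; rewrite /gsat -ltnS ltn_ord /=.
    have kn : (k <= n)%N by rewrite -ltnS.
    by rewrite /sat level_ray // -(anc_ray gr kn); apply/eqP.
  case: (ex_minnP gsat_ex) => k /andP[kn gk] kmin.
  have gtop : top (g k).
    rewrite /top gk level_ray //= kn /=; apply/forallP => j.
    have jk : (j < k)%N by rewrite (leq_trans (ltn_ord j)) ?level_ray.
    rewrite anc_ray ?(ltnW jk) //; apply/negP => js.
    by have := kmin j; rewrite /gsat js (leq_trans (ltnW jk) kn) leqNgt jk => /(_ erefl).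
  have gkr : g k != rho.
    apply: contraTneq gk => gkr; rewrite /sat gkr level_root total.
    by rewrite lt_eqF.
  have [e ek] := edge_to_ex gkr.
  have el : elevel e = k by rewrite /elevel -/(far_end e) ek level_ray.
  exists e; split; first by split; [rewrite /= ek|apply/ray_edgeP => //; rewrite el].
  move=> f [/= ft /(ray_edgeP _ gr) gf]; apply: far_end_inj; rewrite ek -gf.
  congr g; rewrite -gf in ft.
  apply: (top_inj (g (maxn k (elevel f)))); rewrite ?level_ray ?anc_ray // ?leq_maxl ?leq_maxr //.
apply: ge_ereal_sup => _ [F [finF Fpi] <-].
rewrite fsbig_finite //= sumEFin lee_fin.
have capE e : e \in fset_set F ->
    cap (elevel e) = \sum_(y <- Sphere n | anc (elevel e) y == far_end e) w y.
  by rewrite in_fset_set // => /set_mem /Fpi /and3P[/eqP].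
rewrite (eq_big_seq _ capE) (exchange_big_dep predT) //=.
rewrite big_seq [leRHS]big_seq; apply: ler_sum => y; rewrite in_Sphere => /eqP yn.
rewrite big_const_seq iter_addr_0 -[leRHS]mulr1n; apply: ler_wpMn2l => //.
rewrite -size_filter; set s := [seq _ <- _ | _].
have su : uniq s by apply: filter_uniq; exact: fset_uniq.
have s1 e f : e \in s -> f \in s -> e = f.
  rewrite !mem_filter !in_fset_set // => /andP[/eqP ey /set_mem /Fpi /= te'].
  move=> /andP[/eqP fy /set_mem /Fpi /= tf']; apply: far_end_inj; rewrite -ey -fy.
  have [te tf] := (te', tf'); rewrite -ey in te; rewrite -fy in tf.
  congr anc; apply: top_inj te tf.
    by case/and3P: te'; rewrite -/(elevel e) yn.
  by case/and3P: tf'; rewrite -/(elevel f) yn.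
case: s su s1 => [//|a [//|b s]] /= /andP[ab _] /(_ a b).
by rewrite !inE !eqxx orbT => /(_ erefl erefl) abE; rewrite abE inE eqxx in ab.
Qed.

End Flow.

(** * Two estimates for the probability of a union *)

Section Union.
Context (R : realType) (d : measure_display) (Omega : measurableType d).
Variable P : probability Omega R.
Variable I : choiceType.
Implicit Types (A : I -> set Omega) (s : seq I).

(** An injection of [D] into [nat] reduces this to sequences of sets, completed by
    the empty set outside its range. *)
Lemma countable_subadditive (D : set I) A (B : set Omega) : countable D ->
  (forall i, measurable (A i)) -> measurable B -> B `<=` \bigcup_(i in D) A i ->
  (P B <= \esum_(i in D) P (A i))%E.
Proof.
move=> /countable_injP[f finj] mA mB BA.
pose F n := \bigcup_(i in D `&` [set i | f i = n]) A i.
have FE i : D i -> F (f i) = A i.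
  move=> Di; apply/seteqP; split=> w; last by exists i.
  by case=> j [Dj /= fji]; rewrite (finj j i) ?inE.
have F0 n : ~ (f @` D) n -> F n = set0.
  move=> fDn; rewrite -subset0 => w [i [Di /= fi] _]; apply: fDn.
  by exists i.
have mF n : measurable (F n).
  by have [[i Di <-]|/F0 ->] := pselect ((f @` D) n); [rewrite FE|exact: measurable0].
apply: (@le_trans _ _ (\sum_(0 <= n <oo) P (F n))%E).
  apply: measure_sigma_subadditive => // w /BA[i Di Aiw].
  by exists (f i) => //; rewrite FE.
rewrite nneseries_esumT // (esumID (f @` D)) // setTI.
rewrite [X in (_ + X)%E]esum1 ?adde0 => [|n [_ /F0 ->]]; last exact: measure0.
rewrite esum_image; last by move=> i j; exact: finj.
by apply: le_esum => i Di; rewrite FE.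
Qed.

Lemma integral_sum_indic s (c : I -> R) A :
  (forall i, 0 <= c i) -> (forall i, measurable (A i)) ->
  (\int[P]_t \sum_(i <- s) (c i)%:E * (\1_(A i) t)%:E =
   \sum_(i <- s) (c i)%:E * P (A i))%E.
Proof.
move=> c0 mA; have mI i : measurable_fun setT (EFin \o (\1_(A i) : Omega -> R)).
  by apply/measurable_EFinP; exact: measurable_indic.
rewrite ge0_integral_sum //=; last 2 first.
  by move=> i; apply: emeasurable_funM; [exact: measurable_cst|exact: mI].
  by move=> i t _; rewrite mule_ge0 ?lee_fin.
apply: eq_bigr => i _; rewrite ge0_integralZl_EFin //; last exact: mI.
by rewrite integral_indic // setIT.
Qed.

End Union.

(** Integrate [2 X <= 1 + X ^ 2], valid where [X := \sum_i w i * 1_(A i)] does not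
    vanish; scaling [w] optimally turns this into the Paley-Zygmund bound
    [P (X != 0) >= (E X) ^ 2 / E (X ^ 2)]. *)
Lemma second_moment (R : realType) (d : measure_display) (Omega : measurableType d)
    (P : probability Omega R) (I : choiceType) (s : seq I) (w : I -> R)
    (A : I -> set Omega) :
  (forall i, 0 <= w i) -> (forall i, measurable (A i)) ->
  (\sum_(i <- s) (2 * w i)%:E * P (A i) <= P (\bigcup_(i in [set` s]) A i) +
   \sum_(i <- s) \sum_(j <- s) (w i * w j)%:E * P (A i `&` A j))%E.
Proof.
move=> w0 mA; set U := \bigcup_(i in _) _.
have mU : measurable U by apply: fin_bigcup_measurable.
have mI (B : set Omega) : measurable B -> measurable_fun setT (EFin \o (\1_B : Omega -> R)).
  by move=> mB; apply/measurable_EFinP; exact: measurable_indic.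
pose A2 (ij : I * I) := A ij.1 `&` A ij.2.
have mA2 ij : measurable (A2 ij) by apply: measurableI.
pose w2 (ij : I * I) := w ij.1 * w ij.2.
have w20 ij : 0 <= w2 ij by rewrite mulr_ge0.
pose s2 := [seq (i, j) | i <- s, j <- s].
have -> : (\sum_(i <- s) \sum_(j <- s) (w i * w j)%:E * P (A i `&` A j) =
    \sum_(ij <- s2) (w2 ij)%:E * P (A2 ij))%E by rewrite big_allpairs.
have w10 i : 0 <= 2 * w i by rewrite mulr_ge0.
rewrite -integral_sum_indic // -integral_sum_indic //.
rewrite -[P U](_ : \int[P]_t (\1_U t)%:E = _)%E; last by rewrite integral_indic // setIT.
have msum (J : choiceType) (r : seq J) (c : J -> R) (B : J -> set Omega) :
    (forall j, measurable (B j)) ->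
    measurable_fun setT ((fun t => \sum_(i <- r) (c i)%:E * (\1_(B i) t)%:E)%E : Omega -> \bar R).
  move=> mB; apply: emeasurable_sum => j; apply: emeasurable_funM.
    exact: measurable_cst.
  exact: mI.
have sum0 (J : choiceType) (r : seq J) (c : J -> R) (B : J -> set Omega) t :
    (forall j, 0 <= c j) -> (0 <= \sum_(i <- r) (c i)%:E * (\1_(B i) t)%:E :> \bar R)%E.
  by move=> c0; apply: sume_ge0 => j _; rewrite mule_ge0 ?lee_fin.
rewrite -ge0_integralD //; last 3 first.
- exact: mI.
- by move=> *; exact: sum0.
- exact: msum.
apply: ge0_le_integral => //.
- by move=> *; exact: sum0.
- exact: msum.
- by apply: emeasurable_funD; [exact: mI|exact: msum].
move=> t _; pose X := \sum_(i <- s) w i * \1_(A i) t.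
have -> : (\sum_(i <- s) (2 * w i)%:E * (\1_(A i) t)%:E = (2 * X)%:E)%E.
  by rewrite mulr_sumr -sumEFin; apply: eq_bigr => i _; rewrite -EFinM mulrA.
have -> : (\sum_(ij <- s2) (w2 ij)%:E * (\1_(A2 ij) t)%:E = (X * X)%:E)%E.
  rewrite big_allpairs big_distrlr /= -sumEFin; apply: eq_bigr => i _.
  rewrite -sumEFin; apply: eq_bigr => j _.
  by rewrite -EFinM /w2 /A2 /= indicI /= mulrACA.
have sq (x : R) : 2 * x <= 1 + x * x by have := sqr_ge0 (x - 1); rewrite expr2; lra.
rewrite -EFinD lee_fin; have [Ut|Ut] := pselect (U t).
  by rewrite indicE mem_set.
suff -> : X = 0 by rewrite !mulr0 addr0.
rewrite /X big_seq big1 // => i si; rewrite indicE memNset ?mulr0 //.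
by move=> Ait; apply: Ut; exists i.
Qed.

(** * Open paths *)

Lemma prod_fsetUI (R : comRingType) (I : choiceType) (A B : {fset I}) (F : I -> R) :
  \prod_(i <- (A `|` B)%fset) F i * \prod_(i <- (A `&` B)%fset) F i =
  \prod_(i <- A) F i * \prod_(i <- B) F i.
Proof.
rewrite (big_fsetID _ (mem A) (A `|` B)%fset) (big_fsetID _ (mem A) B) /=.
have -> : [fset x | x in (A `|` B)%fset & x \in A]%fset = A.
  by apply/fsetP => x; rewrite !inE /=; case: (x \in A); rewrite ?andbF.
have -> : [fset x | x in B & x \in A]%fset = (A `&` B)%fset.
  by apply/fsetP => x; rewrite !inE /= andbC.
have -> : [fset x | x in (A `|` B)%fset & x \notin A]%fset =
    [fset x | x in B & x \notin A]%fset.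
  by apply/fsetP => x; rewrite !inE /=; case: (x \in A); rewrite ?andbF.
by rewrite -mulrA; congr (_ * _); rewrite mulrC.
Qed.

Section Percolation.
Context (R : realType) (T : rooted_tree).
Hypothesis lf : locally_finite T.
Local Notation rho := (Defs.root T).

Definition open_path (Omega : Type) (op : edge T -> set Omega) x : set Omega :=
  \bigcap_(e in path_edges x) op e.

Lemma open_path_anc (Omega : Type) (op : edge T -> set Omega) m x :
  (m <= level x)%N -> open_path op x `<=` open_path op (anc m x).
Proof.
by move=> mx w xw e; rewrite path_edges_anc // => -[/xw].
Qed.

(** By Koenig's lemma: a vertex with open paths to descendants at all depths has
    a child with this property, since it has finitely many children. *)
Lemma percolatesE (Omega : Type) (op : edge T -> set Omega) :
  [set w | exists g, ray g /\ forall e, ray_edge g e -> op e w] =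
  \bigcap_n \bigcup_(x in @sphere T n) open_path op x.
Proof.
apply/seteqP; split=> w.
  case=> g [gr go] n _; exists (g n); first exact: level_ray.
  move=> e [en ea]; apply: go; apply/ray_edgeP => //.
  by rewrite -ea anc_ray // -{1}(level_ray n gr).
move=> wn.
pose reach x n := exists y, [/\ level y = (level x + n)%N, anc (level x) y = x &
  open_path op y w].
have reachW x m n : (m <= n)%N -> reach x n -> reach x m.
  move=> mn [y [yl yx yo]]; exists (anc (level x + m) y).
  have xmy : (level x + m <= level y)%N by rewrite yl leq_add2l.
  split; first exact: level_anc.
    by rewrite anc_anc // leq_addr.
  exact: open_path_anc yo.
pose good x := forall n, reach x n.
have good_rho : good rho.
  move=> n; have [y yn yo] := wn n I; exists y.
  by rewrite level_root add0n anc0.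
have good_child x : exists y, good x -> [/\ y != rho, parent y = x & good y].
  have [xg|xg] := pselect (good x); last by exists x => /xg.
  suff : exists y, [/\ y != rho, parent y = x & good y] by case=> y; exists y.
  apply: contrapT => noy.
  have /choice[N NP] : forall y, exists n, y != rho -> parent y = x -> ~ reach y n.
    move=> y; apply: contrapT => yN; apply: noy; exists y.
    have ne n : ~ (y != rho -> parent y = x -> ~ reach y n).
      by move=> h; apply: yN; exists n.
    split.
    - by apply: contrapT => h; apply: (ne 0%N) => /h.
    - by apply: contrapT => h; apply: (ne 0%N) => _ /h.
    - by move=> n; apply: contrapT => h; apply: (ne n) => _ _ /h.
  pose C := fset_set [set y | adj x y].
  (* Every child fails to reach depth [M], but one of them lies below a vertex
     reached at depth [M.+1] from [x]. *)
  pose M := \max_(y <- C) N y.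
  have [z [zl zx zo]] := xg M.+1.
  have xz : (level x < level z)%N by rewrite zl addnS ltnS leq_addr.
  have yl := level_anc xz; set y := anc (level x).+1 z in yl.
  have yr : y != rho by exact: anc_neq_root.
  have yx : parent y = x by rewrite /y parent_anc.
  apply: (NP y yr yx); apply: (@reachW _ _ M).
    apply: leq_bigmax_seq => //; rewrite in_fset_set; last exact: lf.
    by apply: mem_set; rewrite /= -yx; exact: adj_parent.
  by exists z; rewrite yl zl; split=> //; lia.
have [f fP] := choice good_child.
pose g n := iter n f rho.
have gg n : good (g n) by elim: n => [//|n /fP[]].
have gr : ray g.
  apply: parent_ray => // n; by have [] := fP _ (gg n).
exists g; split=> // e /(ray_edgeP _ gr) eg.
have [y [yl ye yo]] := gg (elevel e) 0%N.
rewrite eg addn0 in yl ye; rewrite -yl anc_level in ye; rewrite ye in yo.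
by apply: yo; split; rewrite ?leqnn ?anc_level.
Qed.

Context (d : measure_display) (Omega : measurableType d) (P : probability Omega R).
Context (q : nat -> R) (op : edge T -> set Omega).
Hypothesis q_gt0 : forall k, 0 < q k.
Hypothesis perc : bernoulli_percolation P (fun e => q (elevel e)) op.

Definition path_prob n : R := \prod_(1 <= k < n.+1) q k.

Lemma path_prob_gt0 n : 0 < path_prob n.
Proof. by apply: prodr_gt0. Qed.

Lemma prod_path_edges (x : vertex T) :
  \prod_(e <- fset_set (path_edges x)) q (elevel e) = path_prob (level x).
Proof.
elim/tree_ind: x => [|e ih].
  by rewrite path_edges_root fset_set0 level_root /path_prob big_nil big_geq.
rewrite path_edgesS fset_setU1; last exact: finite_path_edges.
rewrite big_fsetU1 /= ?ih; last first.
  rewrite in_fset_set; last exact: finite_path_edges.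
  by apply/negP => /set_mem; exact: path_edgesN.
have le : elevel e = (level (parent (far_end e))).+1.
  exact: level_parent (far_end_neq_root e).
have -> : level (far_end e) = (level (parent (far_end e))).+1 := le.
by rewrite le /path_prob [RHS]big_nat_recr //= mulrC.
Qed.

Lemma measurable_open_path (x : vertex T) : measurable (open_path op x).
Proof.
by apply: fin_bigcap_measurable => [|e _]; [exact: finite_path_edges|case: perc].
Qed.

Lemma prob_bigcap_open (S : set (edge T)) : finite_set S ->
  P (\bigcap_(e in S) op e) = (\prod_(e <- fset_set S) q (elevel e))%:E.
Proof.
move=> finS; case: perc => _ ind marg.
rewrite -[in LHS](fset_setK finS) ind -prodEFin.
by apply: eq_bigr => e _; exact: marg.
Qed.

Lemma prob_open_path (x : vertex T) : P (open_path op x) = (path_prob (level x))%:E.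
Proof. by rewrite prob_bigcap_open ?prod_path_edges //; exact: finite_path_edges. Qed.

(** Given that their common initial segment is open, the two paths are open
    independently. *)
Lemma prob_open_pathI (x y : vertex T) : exists m, [/\ (m <= level x)%N, (m <= level y)%N,
  anc m x = anc m y & P (open_path op x `&` open_path op y) =
    (path_prob (level x) * path_prob (level y) / path_prob m)%:E].
Proof.
have [m [mx my mxy mI]] := path_edgesI x y; exists m; split=> //.
have [finx finy] := (finite_path_edges x, finite_path_edges y).
rewrite /open_path -bigcap_setU prob_bigcap_open ?finite_setU //.
congr (_%:E); rewrite -!prod_path_edges -prod_fsetUI -fset_setU // -fset_setI //.
rewrite mI prod_path_edges level_anc // mulfK //.
by rewrite gt_eqF // path_prob_gt0.
Qed.

Lemma measurable_reach n : measurable (\bigcup_(x in @sphere T n) open_path op x).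
Proof.
by apply: fin_bigcup_measurable => [|x _]; [exact: finite_sphere|exact: measurable_open_path].
Qed.

Lemma measurable_percolates : measurable (percolates op).
Proof.
by rewrite /percolates percolatesE; apply: bigcap_measurableType => n _; exact: measurable_reach.
Qed.

(** Continuity from above along the decreasing events that level [n] is reached. *)
Lemma prob_percolates_ge c :
  (forall n, c <= P (\bigcup_(x in @sphere T n) open_path op x))%E ->
  (c <= P (percolates op))%E.
Proof.
move=> cn; rewrite /percolates percolatesE.
have cvgP := @nonincreasing_cvg_mu _ _ _ P
  (fun n => \bigcup_(x in @sphere T n) open_path op x).
have {}cvgP : P (\bigcup_(x in @sphere T n) open_path op x) @[n --> \oo] -->
    P (\bigcap_n \bigcup_(x in @sphere T n) open_path op x).
  apply: cvgP; first by apply: le_lt_trans (ltry 1); exact: probability_le1 (measurable_reach _).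
  - exact: measurable_reach.
  - by rewrite -percolatesE; exact: measurable_percolates.
  - move=> n m nm; apply/subsetPset => w [x xm xw]; exists (anc n x).
      by apply: level_anc; rewrite xm.
    by apply: open_path_anc xw; rewrite xm.
rewrite -(cvg_lim _ cvgP) //; apply: lime_ge; first by apply/cvg_ex; eexists; exact: cvgP.
by apply: nearW.
Qed.

Lemma countable_edge (D : set (edge T)) : countable D.
Proof.
apply: (@sub_countable _ _ _ (\bigcup_n [set e : edge T | elevel e = n])).
  by apply: subset_card_le => e _; exists (elevel e).
apply: bigcup_countable => // n _; apply: finite_set_countable.
have -> : [set e : edge T | elevel e = n] = @far_end T @^-1` @sphere T n by [].
apply: finite_preimage; last exact: finite_sphere.
by move=> e f _ _; exact: far_end_inj.
Qed.

(** An infinite open path crosses the cutset at an edge joined to the root by open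
    edges; sum over the edges of the cutset, which are countably many. *)
Lemma prob_percolates_le (pi : set (edge T)) : cutset pi ->
  (P (percolates op) <= \esum_(e in pi) (path_prob (elevel e))%:E)%E.
Proof.
move=> cpi; have mA (e : edge T) : measurable (open_path op (far_end e)).
  exact: measurable_open_path.
have percA : percolates op `<=` \bigcup_(e in pi) open_path op (far_end e).
  move=> w [g [gr go]]; have [e [[pie /(ray_edgeP _ gr) eg] _]] := cpi g gr.
  exists e => // f [fe fa]; apply: go; apply/(ray_edgeP _ gr).
  by rewrite -fa -eg anc_ray // -[leqRHS](level_ray _ gr) eg.
apply: (le_trans (countable_subadditive P (countable_edge pi) mA
  measurable_percolates percA)).
by apply: le_esum => e _; rewrite prob_open_path.
Qed.

End Percolation.

(** * Percolation from a flow of finite energy *)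

(** Exchange the sums: the common ancestor of level [k] contributes, for fixed
    [x], the mass [w x] times the load of the ancestor [anc k x] of [x], and this load
    is at most [cap k]. *)
Lemma flow_energy (R : realType) (T : rooted_tree) (cap Q : nat -> R) n
    (w : vertex T -> R) : (forall k, 0 < Q k) -> (forall y, 0 <= w y) ->
  (forall k z, (k <= n)%N -> load n w k z <= cap k) ->
  \sum_(x <- Sphere T n) \sum_(y <- Sphere T n) w x * w y *
    (\sum_(k < n.+1 | anc k x == anc k y) (Q k)^-1) <=
  (\sum_(x <- Sphere T n) w x) * \sum_(k < n.+1) cap k / Q k.
Proof.
move=> Q0 w0 wcap; rewrite mulr_suml; apply: ler_sum => x _.
have -> : \sum_(y <- Sphere T n) w x * w y * (\sum_(k < n.+1 | anc k x == anc k y) (Q k)^-1) =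
    w x * \sum_(k < n.+1) load n w k (anc k x) / Q k.
  rewrite mulr_sumr; under eq_bigr do rewrite mulr_sumr.
  rewrite (exchange_big_dep predT) //=; apply: eq_bigr => k _.
  rewrite /load mulr_suml mulr_sumr; apply: eq_big => [y|y _]; first by rewrite eq_sym.
  by rewrite mulrA.
apply: ler_wpM2l => //; apply: ler_sum => k _.
by apply: ler_wpM2r; [rewrite invr_ge0 ltW|apply: wcap; rewrite -ltnS].
Qed.

(** The second moment method applied to the number of vertices of the sphere
    connected to the root, weighted by the flow of [flow_or_cut].  The resulting
    lower bound [delta / S] for the probability of reaching level [n] is uniform in
    [n], hence it passes to the limit. *)
Lemma prob_percolates_gt0 (R : realType) (T : rooted_tree)
    (d : measure_display) (Omega : measurableType d) (P : probability Omega R)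
    (q cap : nat -> R) (op : edge T -> set Omega) (S delta : R) :
  locally_finite T -> (forall k, 0 < q k) -> (forall k, 0 < cap k) ->
  bernoulli_percolation P (fun e => q (elevel e)) op ->
  (forall n, \sum_(k < n) cap k / path_prob q k <= S) ->
  0 < delta -> delta <= cap 0%N ->
  (forall pi : set (edge T), cutset pi ->
     (delta%:E <= \esum_(e in pi) (cap (elevel e))%:E)%E) ->
  (0 < P (percolates op))%E.
Proof.
move=> lf q0 cap0 perc capS delta0 deltacap deltacut.
have Q0 := path_prob_gt0 q0.
have S0 : 0 < S.
  apply: lt_le_trans (capS 1%N); rewrite big_ord_recl big_ord0 addr0.
  by rewrite divr_gt0.
apply: (@lt_le_trans _ _ (delta / S)%:E); first by rewrite lte_fin divr_gt0.
apply: (prob_percolates_ge lf perc) => n.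
have [w [w0 wcap wtot]] := flow_or_cut lf n cap0.
set F := \sum_(y <- _) w y in wtot.
have deltaF : delta <= F.
  case: wtot => [/(le_trans deltacap) //|[pi cpi piF]].
  by rewrite -lee_fin; apply: le_trans piF; exact: deltacut.
have -> : \bigcup_(x in @sphere T n) open_path op x =
    \bigcup_(x in [set` (Sphere T n : seq _)]) open_path op x.
  by congr bigcup; apply/seteqP; split=> x /=; rewrite in_Sphere // => /eqP.
(* The scaling for which the first moment is [F / S] and the second one at most
   the same. *)
pose c := (path_prob q n * S)^-1.
have c0 : 0 <= c by rewrite invr_ge0 mulr_ge0 // ltW.
have cw0 y : 0 <= c * w y by rewrite mulr_ge0.
have := second_moment P (Sphere T n) cw0 (measurable_open_path perc).
have -> : (\sum_(x <- Sphere T n) (2 * (c * w x))%:E * P (open_path op x) =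
    (2 * F / S)%:E)%E.
  rewrite -mulrA mulr_suml mulr_sumr -sumEFin big_seq [RHS]big_seq.
  apply: eq_bigr => x; rewrite in_Sphere // => /eqP xn.
  rewrite (prob_open_path perc) xn -EFinM /c; congr (_%:E).
  by field; rewrite !gt_eqF.
move=> sm; have {}sm : ((2 * F / S)%:E <=
    P (\bigcup_(x in [set` (Sphere T n : seq _)]) open_path op x) + (F / S)%:E)%E.
  apply: (le_trans sm); apply: leeD => //.
  pose g (x y : vertex T) := \sum_(k < n.+1 | anc k x == anc k y) (path_prob q k)^-1.
  apply: (@le_trans _ _ (\sum_(x <- Sphere T n) \sum_(y <- Sphere T n)
      (c ^+ 2 * path_prob q n ^+ 2 * (w x * w y * g x y))%:E)%E).
    rewrite big_seq [leRHS]big_seq; apply: lee_sum => x; rewrite in_Sphere // => /eqP xn.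
    rewrite big_seq [leRHS]big_seq; apply: lee_sum => y; rewrite in_Sphere // => /eqP yn.
    have [m [mx my mxy ->]] := prob_open_pathI q0 perc x y.
    rewrite xn yn -EFinM lee_fin.
    have -> : c * w x * (c * w y) * (path_prob q n * path_prob q n / path_prob q m) =
        c ^+ 2 * path_prob q n ^+ 2 * (w x * w y * (path_prob q m)^-1) by ring.
    apply: ler_wpM2l; first by rewrite mulr_ge0 // sqr_ge0.
    apply: ler_wpM2l; first by rewrite mulr_ge0.
    have mn : (m < n.+1)%N by rewrite ltnS -xn.
    (* The last common ancestor alone accounts for the joint probability. *)
    rewrite /g (bigD1 (Ordinal mn)) /= ?mxy // lerDl.
    by apply: sumr_ge0 => k _; rewrite invr_ge0 ltW.
  under eq_bigr do rewrite sumEFin -mulr_sumr.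
  rewrite sumEFin -mulr_sumr lee_fin.
  apply: (@le_trans _ _ (c ^+ 2 * path_prob q n ^+ 2 * (F * S))).
    apply: ler_wpM2l; first by rewrite mulr_ge0 // sqr_ge0.
    apply: le_trans (flow_energy Q0 w0 wcap) _.
    by apply: ler_wpM2l; [exact: le_trans (ltW delta0) deltaF|exact: capS].
  rewrite le_eqVlt; apply/orP; left; apply/eqP; rewrite /c.
  by field; rewrite !gt_eqF.
apply: (@le_trans _ _ (F / S)%:E).
  by rewrite lee_fin ler_wpM2r // invr_ge0 ltW.
rewrite -(@leeD2rE _ (F / S)%:E) // -EFinD.
by apply: le_trans sm; rewrite lee_fin; lra.
Qed.

(** * Estimates for stretched exponentials *)

Section Estimates.
Context (R : realType).
Implicit Types (a t lam mu theta eps : R) (n k : nat).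

(** Young's inequality with conjugate exponents [theta^-1] and [(1 - theta)^-1],
    applied to [t `^ theta] and 1. *)
Lemma powR_bernoulli theta t : 0 < theta < 1 -> 0 <= t ->
  t `^ theta <= 1 + theta * (t - 1).
Proof.
move=> /andP[h0 h1] t0.
have := @conjugate_powR R (t `^ theta) 1 theta^-1 (1 - theta)^-1.
rewrite powR1 -powRrM mulfV ?gt_eqF // powRr1 // !invrK mulr1 mul1r.
move=> h; suff : t `^ theta <= t * theta + (1 - theta) by lra.
by apply: h; rewrite ?powR_ge0 ?invr_gt0 ?subr_gt0 //; lra.
Qed.

(** Rescale the tangent bound of [powR_bernoulli] to the point [M] where the
    slope of [a `^ theta] is at most [eps]. *)
Lemma powR_le_affine theta eps : 0 < theta < 1 -> 0 < eps ->
  exists2 C : R, 0 <= C & forall a, 0 <= a -> a `^ theta <= eps * a + C.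
Proof.
move=> /andP[h0 h1] e0; pose M := eps `^ ((theta - 1)^-1).
have M0 : 0 < M by apply: powR_gt0.
have Me : M `^ theta = eps * M.
  have : M * M `^ (theta - 1) = M `^ theta by rewrite mulr_powRB1 // ltW.
  rewrite {2}/M -powRrM mulVf ?powRr1 ?ltW // ?lt_eqF ?subr_lt0 // => <-.
  by rewrite mulrC.
exists (M `^ theta); first exact: powR_ge0.
move=> a a0; have aM0 : 0 <= a / M by rewrite divr_ge0 // ltW.
have -> : a `^ theta = M `^ theta * (a / M) `^ theta.
  by rewrite -powRM ?(ltW M0) // mulrC divfK // gt_eqF.
apply: (@le_trans _ _ (M `^ theta * (1 + a / M))).
  apply: ler_wpM2l; first exact: powR_ge0.
  have h : 0 < theta < 1 by rewrite h0.
  by apply: (le_trans (powR_bernoulli h aM0)); nra.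
rewrite mulrDr mulr1 addrC lerD2r Me.
by have -> : eps * M * (a / M) = eps * a by field; rewrite gt_eqF.
Qed.

(** The [n] terms are at least the last one, as the exponent is nonpositive. *)
Lemma sum_powR_ge lam n : 0 < lam <= 1 ->
  n%:R `^ lam <= \sum_(1 <= k < n.+1) k%:R `^ (-1 + lam).
Proof.
move=> /andP[l0 l1]; case: n => [|n]; first by rewrite big_geq // powR0 ?gt_eqF.
have -> : n.+1%:R `^ lam = \sum_(1 <= k < n.+2) n.+1%:R `^ (-1 + lam) :> R.
  rewrite sumr_const_nat subn1 /= -[RHS]mulr_natl -[in LHS](@mulr_powRB1 _ _ lam) //.
  by rewrite addrC.
apply: ler_sum_nat => k /andP[k1 kn].
have -> : -1 + lam = - (1 - lam) by rewrite opprB addrC.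
rewrite !powRN lef_pV2 ?posrE ?powR_gt0 ?ltr0n //.
apply: ge0_ler_powR; rewrite ?nnegrE ?ler0n ?subr_ge0 //.
by rewrite ler_nat.
Qed.

Lemma sum_powR_ge1 lam n : 1 <= lam ->
  n%:R <= \sum_(1 <= k < n.+1) k%:R `^ (-1 + lam).
Proof.
move=> l1; have -> : n%:R = \sum_(1 <= k < n.+1) 1 :> R by rewrite sumr_const_nat subn1.
apply: ler_sum_nat => k /andP[k1 kn].
rewrite -[leLHS](powRr0 (k%:R : R)); apply: ler_powR; first by rewrite ler1n.
by rewrite addrC subr_ge0.
Qed.

(** By induction: [k `^ (-1 + lam) <= (k `^ lam - (k - 1) `^ lam) / lam], which is
    [powR_bernoulli] at [t := (k - 1) / k]. *)
Lemma sum_powR_le lam n : 0 < lam < 1 ->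
  \sum_(1 <= k < n.+1) k%:R `^ (-1 + lam) <= n%:R `^ lam / lam.
Proof.
move=> l01; have /andP[l0 l1] := l01; elim: n => [|n ih].
  by rewrite big_geq // divr_ge0 ?powR_ge0 // ltW.
rewrite big_nat_recr //=; apply: (le_trans (lerD ih (lexx _))).
rewrite -lerBrDl -mulrBl ler_pdivlMr //.
have x0 : 0 < n.+1%:R :> R by rewrite ltr0n.
have u0 : 0 <= n%:R / n.+1%:R :> R by rewrite divr_ge0.
have -> : n%:R `^ lam = n.+1%:R `^ lam * (n%:R / n.+1%:R) `^ lam :> R.
  by rewrite -powRM ?(ltW x0) // mulrC divfK // gt_eqF.
have -> : n.+1%:R `^ lam = n.+1%:R * n.+1%:R `^ (-1 + lam) :> R.
  by rewrite (addrC (-1)) mulr_powRB1 // ltW.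
have p0 := powR_gt0 (-1 + lam) x0.
have := powR_bernoulli l01 u0.
set X := _ `^ (-1 + lam) in p0 *; set Y := _ `^ lam.
have -> : n%:R / n.+1%:R - 1 = - n.+1%:R^-1 :> R.
  by rewrite -natr1; field; rewrite natr1 gt_eqF.
set N := n.+1%:R in x0 *; move=> hY.
have : N * X * Y <= N * X * (1 + lam * - N^-1) by rewrite ler_wpM2l // mulr_ge0 // ltW.
have -> : N * X * (1 + lam * - N^-1) = N * X - X * lam by field; rewrite gt_eqF.
by lra.
Qed.

(** The sharper bound [2 - n.+1%:R^-1] is preserved by induction. *)
Lemma sum_inv_sqr_le n : \sum_(k < n) (k.+1%:R ^- 2 : R) <= 2.
Proof.
suff : \sum_(k < n.+1) (k.+1%:R ^- 2 : R) <= 2 - n.+1%:R^-1.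
  rewrite big_ord_recr /= => h.
  apply: (@le_trans _ _ (2 - n.+1%:R^-1)); last by rewrite gerBl invr_ge0.
  by apply: le_trans h; rewrite lerDl invr_ge0 exprn_ge0.
elim: n => [|n ih].
  by rewrite big_ord_recl big_ord0 expr1n invr1; lra.
rewrite big_ord_recr /=; apply: (le_trans (lerD ih (lexx _))).
have x0 : 0 < n.+1%:R :> R by rewrite ltr0n.
rewrite -(natr1 n.+1); set x := n.+1%:R in x0 *.
rewrite -lerBrDl -subr_ge0.
have -> : 2 - (x + 1)^-1 - (2 - x^-1) - (x + 1) ^- 2 = (x * (x + 1) ^+ 2)^-1.
  by field; rewrite !gt_eqF //; lra.
by rewrite invr_ge0 mulr_ge0 ?sqr_ge0 // ltW.
Qed.

Lemma expR_gt_powR m a : 0 <= a -> a ^+ m.+1 / m.+1`!%:R <= expR a.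
Proof. by move=> a0; apply: le_trans (expR_ge1Dxn m a0); rewrite lerDr. Qed.

(** For [mu < lam] the exponent [k `^ mu / mu] is at most half of [k `^ lam] up
    to a constant, and [expR (- k `^ lam / 2)] decays faster than [k ^- 2]. *)
Lemma sum_stretched_exp_le mu lam : 0 < mu < lam -> exists S : R, forall n,
  \sum_(k < n) expR (- (k%:R `^ lam)) * expR (k%:R `^ mu / mu) <= S.
Proof.
move=> /andP[m0 ml]; have l0 := lt_trans m0 ml.
have th : 0 < mu / lam < 1 by rewrite divr_gt0 //= ltr_pdivrMr // mul1r.
have [C C0 CP] := powR_le_affine th (divr_gt0 m0 (ltr0n R 2)).
have [m ml2] : exists m, 2 <= lam * m.+1%:R.
  exists (Num.bound (2 / lam)); rewrite mulrC -ler_pdivrMr //; apply: ltW.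
  apply: lt_le_trans (archi_boundP _) _; first by rewrite divr_ge0 // ltW.
  by rewrite ler_nat.
pose K := expR (C / mu) * (2 ^+ m.+1 * m.+1`!%:R).
have K0 : 0 <= K by rewrite /K !mulr_ge0 ?expR_ge0 ?exprn_ge0.
have term k : (0 < k)%N ->
    expR (- (k%:R `^ lam)) * expR (k%:R `^ mu / mu) <= K * k%:R ^- 2.
  move=> k0; set a := k%:R `^ lam; have a0 : 0 < a by rewrite powR_gt0 ?ltr0n.
  have -> : k%:R `^ mu = a `^ (mu / lam) :> R.
    by rewrite /a -powRrM mulrCA divff ?mulr1 // gt_eqF.
  have h1 : a `^ (mu / lam) / mu <= a / 2 + C / mu.
    rewrite ler_pdivrMr //; apply: (le_trans (CP _ (ltW a0))).
    by rewrite mulrDl divfK ?gt_eqF // lerD2r; lra.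
  apply: (@le_trans _ _ (expR (C / mu) * expR (- (a / 2)))).
    by rewrite -!expRD ler_expR; lra.
  rewrite /K -mulrA; apply: ler_wpM2l; first exact: expR_ge0.
  rewrite expRN -[leRHS]invrK lef_pV2 ?posrE ?expR_gt0 ?invr_gt0 ?mulr_gt0 ?invr_gt0
    ?exprn_gt0 ?ltr0n ?fact_gt0 //.
  have a20 : 0 <= a / 2 by rewrite divr_ge0 // ltW.
  apply: le_trans (expR_gt_powR m a20).
  rewrite invfM invrK mulrC exprMn exprVn invfM mulrA.
  rewrite ler_wpM2r ?invr_ge0 // ler_wpM2r ?invr_ge0 ?exprn_ge0 //.
  rewrite -!powR_mulrn ?(ltW a0) // /a -powRrM; apply: ler_powR => //.
  by rewrite ler1n.
exists (1 + K * 2) => -[|n].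
  by rewrite big_ord0 addr_ge0 // mulr_ge0.
rewrite big_ord_recl /= !powR0 ?gt_eqF // oppr0 mul0r expR0 mulr1 lerD2l.
apply: (@le_trans _ _ (\sum_(k < n) K * k.+1%:R ^- 2)).
  by apply: ler_sum => k _; exact: term.
by rewrite -mulr_sumr; apply: ler_wpM2l => //; exact: sum_inv_sqr_le.
Qed.

Definition level_prob lam k : R := expR (- (k%:R `^ (-1 + lam))).

Lemma level_prob_gt0 lam k : 0 < level_prob lam k.
Proof. exact: expR_gt0. Qed.

Lemma path_level_prob lam n :
  path_prob (level_prob lam) n = expR (- \sum_(1 <= k < n.+1) k%:R `^ (-1 + lam)).
Proof. by rewrite /path_prob -sumrN expR_sum. Qed.

End Estimates.

(** * Subexponential growth *)

(** For large [n] the growth condition bounds the size of level [n] by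
    [expR (n `^ c)] with [c < 1], and [n `^ c <= n / 2 + C]. *)
Lemma subexponential_growth (R : realType) (T : rooted_tree) (eps : R) :
  (limn_esup (@growth_ratio R T) < 1)%E -> 0 < eps ->
  exists2 n, (0 < n)%N & #|` Sphere T n|%:R * expR (- n%:R) < eps.
Proof.
rewrite /limn_esup limf_esupE => /ereal_inf_lt[_ [V [N _ NV] <-] supV] e0.
have [c c01 cV] : exists2 c : R, 0 < c < 1 &
    forall n, (N <= n)%N -> (@growth_ratio R T n <= c%:E)%E.
  have supP n : (N <= n)%N -> (@growth_ratio R T n <= ereal_sup (@growth_ratio R T @` V))%E.
    by move=> Nn; apply: ereal_sup_ubound; exists n => //; exact: NV.
  case: ereal_sup supV supP => [r| |] //.
    rewrite lte_fin => r1 rP; exists (Num.max r 2^-1).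
      by rewrite lt_max gt_max r1 (_ : 0 < 2^-1) ?orbT //=; lra.
    by move=> n /rP /le_trans; apply; rewrite lee_fin le_max lexx.
  move=> _ rP; exists 2^-1; first by lra.
  by move=> n /rP /le_trans; apply; exact: leNye.
have [C C0 CP] := @powR_le_affine R c 2^-1 c01 ltac:(lra).
pose n := maxn (maxn N 2) (Num.bound (`|2 * (C - ln eps)|)).
have Nn : (N <= n)%N by rewrite /n !leq_max leqnn.
have n2 : (2 <= n)%N by rewrite /n !leq_max leqnn orbT.
have nC : 2 * (C - ln eps) < n%:R.
  apply: le_lt_trans (ler_norm _) _.
  apply: lt_le_trans (archi_boundP (normr_ge0 _)) _.
  by rewrite ler_nat /n leq_max leqnn orbT.
have card_le : #|` Sphere T n|%:R <= expR (n%:R `^ c) :> R.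
  have [s1|s1] := leP (#|` Sphere T n|%:R : R) 1.
    by apply: (le_trans s1); rewrite -expR0 ler_expR powR_ge0.
  have lnn : 0 < ln (n%:R : R) by rewrite ln_gt0 // ltr1n.
  have lns := ln_gt0 s1.
  have := cV n Nn; rewrite /growth_ratio -/(Sphere T n) lne_EFin ?(lt_trans ltr01 s1) //.
  rewrite lne_EFin // -EFinM lee_fin ler_pdivrMr // => h.
  rewrite -[leLHS]lnK ?posrE ?(lt_trans ltr01 s1) // ler_expR.
  rewrite -[leLHS]lnK ?posrE // /powR gt_eqF ?ltr0n ?ler_expR //.
  exact: leq_trans n2.
exists n; first exact: leq_trans n2.
apply: (@le_lt_trans _ _ (expR (n%:R `^ c) * expR (- n%:R))).
  by rewrite ler_wpM2r ?expR_ge0.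
rewrite -expRD -[ltRHS]lnK ?posrE // ltr_expR.
by have := CP n%:R (ler0n _ _); lra.
Qed.

Lemma esum_level (R : realType) (T : rooted_tree) (f : nat -> R) n :
  locally_finite T -> (forall k, 0 <= f k) -> (0 < n)%N ->
  (\esum_(e in [set e : edge T | elevel e = n]) (f (elevel e))%:E =
   (#|` Sphere T n|%:R * f n)%:E)%E.
Proof.
move=> lf f0 n0.
rewrite -(@esum_image _ _ _ _ (@far_end T) (fun x => (f (level x))%:E)); last first.
  by move=> e e' _ _; exact: far_end_inj.
have -> : @far_end T @` [set e : edge T | elevel e = n] = @sphere T n.
  apply/seteqP; split=> [_ [e en <-] //|x xn].
  have xr : x != Defs.root T by apply: contraTneq n0 => xr; rewrite -xn xr level_root.
  by have [e ex] := edge_to_ex xr; exists e => //; rewrite /elevel /= -/(far_end e) ex.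
have fin := finite_sphere n lf.
rewrite esum_fset //; last by move=> x _; rewrite lee_fin.
rewrite fsbig_finite //= sumEFin -/(Sphere T n); congr (_%:E).
rewrite (eq_big_seq (fun=> f n)) => [|x]; last by rewrite in_Sphere // => /eqP ->.
by rewrite big_const_seq count_predT iter_addr_0 mulr_natl.
Qed.

(** * The two suprema *)

Section SupOr0.
Context (R : realType).
Implicit Types (A : set R) (M : \bar R).

Lemma sup_or0_le A M : (0 <= M)%E -> (forall a, A a -> (a%:E <= M)%E) ->
  (sup_or0 A <= M)%E.
Proof.
move=> M0 AM; rewrite /sup_or0; case: asboolP => // _.
by apply: ge_ereal_sup => _ [a Aa <-]; exact: AM.
Qed.

Lemma sup_or0_ge A a : A a -> (a%:E <= sup_or0 A)%E.
Proof.
move=> Aa; rewrite /sup_or0; case: asboolP => [A0|_].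
  by move: Aa; rewrite A0.
by apply: ereal_sup_ubound; exists a.
Qed.

Lemma sup_or0_ge0 A : (forall a, A a -> 0 <= a) -> (0 <= sup_or0 A)%E.
Proof.
move=> A0; have [A_empty|/eqP/set0P[a Aa]] := pselect (A = set0).
  by rewrite /sup_or0 asboolT.
by apply: le_trans (sup_or0_ge Aa); rewrite lee_fin A0.
Qed.

End SupOr0.

(** By the first moment method, as a path of length [n] is open with probability
    at most [expR (- n `^ lam)]. *)
Lemma percolation_cut_weight (R : realType) (T : rooted_tree)
    (d : measure_display) (Omega : measurableType d) (P : probability Omega R)
    (lam : R) (op : edge T -> set Omega) :
  locally_finite T -> bernoulli_percolation P (@open_prob R T lam) op ->
  0 < lam <= 1 -> (0 < P (percolates op))%E ->
  (0 < ereal_inf [set cut_weight lam pi | pi in @cutset T])%E.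
Proof.
move=> lf perc l01 P0; apply: (lt_le_trans P0).
apply: le_ereal_inf_tmp => _ [pi cpi <-].
have := @prob_percolates_le R T lf _ _ P (level_prob lam) op perc pi cpi.
move=> /le_trans; apply; apply: le_esum => e _.
by rewrite lee_fin path_level_prob ler_expR lerN2 sum_powR_ge.
Qed.

(** By the first moment method on a far level, as the number of its vertices is
    negligible with respect to [expR n]. *)
Lemma percolation_le1 (R : realType) (T : rooted_tree)
    (d : measure_display) (Omega : measurableType d) (P : probability Omega R)
    (lam : R) (op : edge T -> set Omega) :
  locally_finite T -> (limn_esup (@growth_ratio R T) < 1)%E ->
  bernoulli_percolation P (@open_prob R T lam) op ->
  (0 < P (percolates op))%E -> lam <= 1.
Proof.
move=> lf growth perc P0; rewrite leNgt; apply/negP => l1.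
have mperc := @measurable_percolates R T lf _ _ P (level_prob lam) op perc.
have : 0 < fine (P (percolates op)).
  by rewrite fine_gt0 // P0 ltey_eq fin_num_measure.
move=> /(subexponential_growth growth)[n n0]; apply/negP; rewrite -leNgt.
rewrite -lee_fin fineK; last exact: fin_num_measure.
have := @prob_percolates_le R T lf _ _ P (level_prob lam) op perc _ (cutset_level n0).
move=> /le_trans; apply; rewrite esum_level //; last first.
  by move=> k; rewrite ltW // path_prob_gt0 // => j; exact: level_prob_gt0.
rewrite lee_fin ler_wpM2l // path_level_prob ler_expR lerN2.
by apply: sum_powR_ge1; exact: ltW.
Qed.

(** The cutset of all edges of level [n] has arbitrarily small weight if
    [lam > 1]. *)
Lemma cut_weight_le1 (R : realType) (T : rooted_tree) (lam : R) :
  locally_finite T -> (limn_esup (@growth_ratio R T) < 1)%E ->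
  (0 < ereal_inf [set cut_weight lam pi | pi in @cutset T])%E -> lam <= 1.
Proof.
move=> lf growth inf0; rewrite leNgt; apply/negP => l1.
have [eps e0 epsinf] : exists2 eps : R, 0 < eps &
    (eps%:E <= ereal_inf [set cut_weight lam pi | pi in @cutset T])%E.
  case: ereal_inf inf0 => [r|_|//]; first by rewrite lte_fin => r0; exists r.
  by exists 1 => //; exact: leey.
have [n n0] := subexponential_growth growth e0; apply/negP; rewrite -leNgt.
rewrite -lee_fin; apply: (le_trans epsinf).
apply: (@le_trans _ _ (cut_weight lam [set e : edge T | elevel e = n])).
  by apply: ereal_inf_lbound; exists [set e : edge T | elevel e = n] => //; exact: cutset_level.
rewrite /cut_weight (@esum_level _ _ (fun k => expR (- (k%:R `^ lam)))) //.
by rewrite lee_fin ler_wpM2l // ler_expR lerN2 le1r_powR ?ler1n // ltW.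
Qed.

(** The flow provided by the cutset condition at exponent [lam] has finite energy
    for the percolation of any smaller parameter. *)
Lemma cut_weight_percolation (R : realType) (T : rooted_tree)
    (d : measure_display) (Omega : measurableType d) (P : probability Omega R)
    (mu lam : R) (op : edge T -> set Omega) :
  locally_finite T -> bernoulli_percolation P (@open_prob R T mu) op ->
  0 < mu < lam -> mu < 1 ->
  (0 < ereal_inf [set cut_weight lam pi | pi in @cutset T])%E ->
  (0 < P (percolates op))%E.
Proof.
move=> lf perc ml mu1 inf0; have /andP[mu0 mulam] := ml.
have [delta d01 deltainf] : exists2 delta : R, 0 < delta <= 1 &
    (delta%:E <= ereal_inf [set cut_weight lam pi | pi in @cutset T])%E.
  case: ereal_inf inf0 => [r|_|//]; last by exists 1; rewrite ?ltr01 ?lexx // leey.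
  rewrite lte_fin => r0; exists (Num.min r 1).
    by rewrite lt_min r0 ltr01 ge_min lexx orbT.
  by rewrite lee_fin ge_min lexx.
have /andP[d0 d1] := d01.
have [S SP] := sum_stretched_exp_le ml.
apply: (@prob_percolates_gt0 R T _ _ P (level_prob mu)
  (fun k => expR (- (k%:R `^ lam))) op S delta) => //.
- exact: level_prob_gt0.
- move=> n; apply: le_trans (SP n); apply: ler_sum => k _.
  apply: ler_wpM2l; first exact: expR_ge0.
  rewrite path_level_prob -expRN opprK ler_expR sum_powR_le //.
  by rewrite mu0 mu1.
- (* The root has capacity 1. *)
  by rewrite powR0 ?gt_eqF ?(lt_trans mu0) // oppr0 expR0.
- move=> pi cpi; apply: (le_trans deltainf).
  by apply: ereal_inf_lbound; exists pi.
Qed.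

Theorem theorem3p3 (R : realType) (T : rooted_tree)
    (T_locally_finite : locally_finite T)
    (T_infinite : infinite_set [set: vertex T])
    (T_growth : intermediate_growth R T)
    (d : measure_display) (Omega : R -> measurableType d)
    (P : forall lam : R, probability (Omega lam) R)
    (op : forall lam : R, edge T -> set (Omega lam))
    (op_percolation : forall lam : R, 0 <= lam ->
       bernoulli_percolation (P lam) (@open_prob R T lam) (op lam)) :
  Theta P op = IBN R T.
Proof.
have [_ growth] := T_growth.
apply/eqP; rewrite eq_le; apply/andP; split.
  apply: sup_or0_le => [|lam [lam0 Plam]].
    by apply: sup_or0_ge0 => lam [/ltW].
  have perc := op_percolation lam lam0.
  have [lam_gt0|lam_le0] := ltP 0 lam; last first.
    apply: (@le_trans _ _ 0%E); first by rewrite lee_fin.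
    by apply: sup_or0_ge0 => mu [/ltW].
  apply: sup_or0_ge; split=> //.
  apply: (percolation_cut_weight T_locally_finite perc) => //.
  by rewrite lam_gt0 (percolation_le1 T_locally_finite growth perc).
have Theta0 : (0 <= Theta P op)%E by apply: sup_or0_ge0 => lam [].
apply: sup_or0_le => // lam [lam0 lam_inf].
rewrite leNgt; apply/negP => Theta_lam.
have [s sE] : exists s, Theta P op = s%:E.
  case: (Theta P op) Theta0 Theta_lam => [s| |] //; by exists s.
move: Theta0 Theta_lam; rewrite sE lee_fin lte_fin => s0 slam.
(* A parameter strictly between [Theta P op] and [lam] would percolate. *)
pose mu := (s + lam) / 2.
have lam1 := cut_weight_le1 T_locally_finite growth lam_inf.
have mu0 : 0 < mu by rewrite /mu; lra.
have : (mu%:E <= Theta P op)%E.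
  apply: sup_or0_ge; split; first exact: ltW.
  apply: (cut_weight_percolation T_locally_finite (op_percolation _ (ltW mu0))) lam_inf.
    by rewrite mu0 /mu; lra.
  by rewrite /mu; lra.
by rewrite sE lee_fin /mu; lra.
Qed.
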